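(* Let $F$ be a graph with $\chi(F)=r+1\ge3$. For every real $p>1$ and every $\varepsilon>0$ there exist $\delta>0$ and $n_0$ such that if $G$ is a graph on $n\ge n_0$ vertices containing no subgraph isomorphic to $F$ and $\lambda^{(p)}(G)\ge\left(1-\frac1r-\delta\right)n^{2-2/p}$, then the edit distance satisfies $d(G,T_r(n))\le\varepsilon n^2$.
   Context: For a graph $G$ on vertex set $\{1,\dots,n\}$ and real $p\ge1$, the $p$-spectral radius is $\lambda^{(p)}(G)=\max\{2\sum_{\{i,j\}\in E(G)}x_ix_j:\ x\in\mathbb R^n,\ |x_1|^p+\dots+|x_n|^p=1\}$. $T_r(n)$ is the complete $r$-partite graph on $n$ vertices with part sizes as equal as possible. For two graphs $G_1,G_2$ on the same $n$-vertex set (up to identification of vertex sets), the edit distance $d(G_1,G_2)$ is the minimum number of edge additions and deletions needed to turn $G_1$ into a graph isomorphic to $G_2$. *)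

(* Defs.v *)
From HB Require Import structures.
From mathcomp Require Import all_boot all_order all_algebra all_fingroup.
From mathcomp Require Import all_classical all_reals all_analysis.
Set Implicit Arguments. Unset Strict Implicit. Unset Printing Implicit Defensive.
Import Order.TTheory GRing.Theory Num.Theory.

Local Open Scope ring_scope.

Definition is_graph (n : nat) (E : {set {set 'I_n}}) : bool :=
  [forall e in E, #|e| == 2%N].

Definition colorable (k : nat) (F : {set {set 'I_k}}) (c : nat) : bool :=
  [exists f : {ffun 'I_k -> 'I_c},
     [forall e in F, forall x in e, forall y in e, (x != y) ==> (f x != f y)]].

(* Chromatic number: least c <= k with F c-colourable (F is always k-colourable). *)
Definition chromatic_number (k : nat) (F : {set {set 'I_k}}) : nat :=
  \big[minn/k]_(c < k.+1 | colorable F c) (c : nat).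

Definition contains_sub (n k : nat) (G : {set {set 'I_n}}) (F : {set {set 'I_k}}) : bool :=
  [exists phi : {ffun 'I_k -> 'I_n}, injectiveb phi && [forall e in F, (phi @: e) \in G]].

(* Turán graph T_r(n): parts = residue classes mod r (sizes differ by at most 1). *)
Definition turan (n r : nat) : {set {set 'I_n}} :=
  [set e : {set 'I_n} | [exists x : 'I_n, exists y : 'I_n,
      ((x %% r)%N != (y %% r)%N) && (e == [set x; y])]].

(* Edit distance: min over vertex relabellings s of |E(G1) Δ s(E(G2))|.
   The neutral element n*n exceeds every symmetric-difference size. *)
Definition relabel (n : nat) (s : 'S_n) (E : {set {set 'I_n}}) : {set {set 'I_n}} :=
  [set [set s v | v in e] | e : {set 'I_n} in E].

Definition edit_dist (n : nat) (G1 G2 : {set {set 'I_n}}) : nat :=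
  \big[minn/(n * n)%N]_(s : 'S_n)
     #|(G1 :\: relabel s G2) :|: (relabel s G2 :\: G1)|.

Definition lambda_p (R : realType) (p : R) (n : nat) (G : {set {set 'I_n}}) : R :=
  sup ([set y : R | exists x : 'I_n -> R,
         (\sum_(i < n) (`|x i| `^ p) = 1) /\ y = 2 * \sum_(e in G) \prod_(v in e) x v])%classic.

(* Main.v *)
Require Import Defs.
From HB Require Import structures.
From mathcomp Require Import all_boot all_order all_algebra all_fingroup.
From mathcomp Require Import all_classical all_reals all_analysis.
From mathcomp Require Import ring lra.
Import Order.TTheory GRing.Theory Num.Theory.
Local Open Scope ring_scope.
Set Implicit Arguments.
Unset Strict Implicit.
Unset Printing Implicit Defensive.

(** Weight the vertices by [y >= 0] of total mass [W <= 1] and let [t_s] be the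
weighted number of ordered [s]-cliques.  By induction on [r], passing to the
neighbourhood of a vertex and using Goodman's bound on [t_3], a small [t_(r+1)]
forces [t_2 <= (1 - 1/r) W^2 + o(1)], and near equality forces the graph to be
nearly [r]-partite: almost all degrees are close to [(1 - 1/r) W], so the
non-neighbours of a typical vertex [v] carry almost no edges, and they form one
class while induction splits the neighbourhood of [v].

By a Kovari-Sos-Turan type counting argument a positive density of
[(r+1)-]cliques yields a complete [(r+1)]-partite graph with large classes,
hence a copy of [F].  So in an [F]-free graph [t_(r+1)] is small for every weight
with [y <= C/n].

For a vector [x] of [p]-norm 1 put [y = |x|^p].  Only [n/C] vertices have
[y > C/n]; on the other pairs Young's inequality bounds the quadratic form by
[n^(2-2/p) (t_2(y) / p + (1 - 1/p) 2e(G)/n^2)].  As [t_2(y) <= 1 - 1/r + o(1)] and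
[p > 1], a large [lambda_p] forces [2e(G) >= (1 - 1/r - o(1)) n^2].  Stability for
the uniform weight then gives a nearly proper [r]-colouring, whose classes must
be nearly balanced. *)

(** * Clique masses of weighted graphs *)

Section CliqueDensity.
Variables (R : realType) (V : finType) (A : rel V).
Implicit Types (y : V -> R) (v : V).

Definition link y v : V -> R := fun u => y u * (A v u)%:R.

(** The number of ordered [s]-cliques, each weighted by the product of its vertex weights. The
    recursion through the link of the first vertex is what the inductions on the clique size
    unfold. *)
Fixpoint clique_mass (s : nat) y : R :=
  if s is s'.+1 then \sum_v y v * clique_mass s' (link y v) else 1.

Lemma link_ge0 y v : (forall u, 0 <= y u) -> forall u, 0 <= link y v u.
Proof. by move=> y0 u; rewrite mulr_ge0 ?ler0n. Qed.

Lemma clique_mass_ge0 s y : (forall u, 0 <= y u) -> 0 <= clique_mass s y.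
Proof.
elim: s y => [|s IHs] y y0 /=; first exact: ler01.
by apply: sumr_ge0 => v _; rewrite mulr_ge0 ?IHs//; exact: link_ge0.
Qed.

Lemma clique_mass1 y : clique_mass 1 y = \sum_v y v.
Proof. by apply: eq_bigr => v _; rewrite mulr1. Qed.

Lemma clique_massS s y :
  clique_mass s.+1 y = \sum_v y v * clique_mass s (link y v).
Proof. by []. Qed.

Lemma clique_mass2 y : clique_mass 2 y = \sum_v y v * \sum_u link y v u.
Proof.
by rewrite clique_massS; apply: eq_bigr => v _; rewrite clique_mass1.
Qed.

Lemma sum_link_le y v :
  (forall u, 0 <= y u) -> \sum_u link y v u <= \sum_u y u.
Proof.
by move=> y0; apply: ler_sum => u _; rewrite ler_piMr// lern1 leq_b1.
Qed.

Lemma clique_mass2_le y :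
  (forall u, 0 <= y u) -> clique_mass 2 y <= (\sum_u y u) ^+ 2.
Proof.
move=> y0; rewrite clique_mass2 expr2 mulr_suml; apply: ler_sum => v _.
by rewrite ler_wpM2l// sum_link_le.
Qed.

Lemma le_clique_mass s y z : (forall u, 0 <= y u <= z u) ->
  clique_mass s y <= clique_mass s z.
Proof.
elim: s y z => [//|s IHs] y z yz /=; apply: ler_sum => v _.
have /andP[yv0 yzv] := yz v; apply: ler_pM => //.
  by apply/clique_mass_ge0/link_ge0 => u; case/andP: (yz u).
apply: IHs => u; case/andP: (yz u) => ? ?.
by rewrite mulr_ge0 ?ler0n//= ler_wpM2r.
Qed.

Lemma clique_massZ s a y :
  clique_mass s (fun u => a * y u) = a ^+ s * clique_mass s y.
Proof.
elim: s y => [|s IHs] y /=; first by rewrite mulr1.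
rewrite mulr_sumr; apply: eq_bigr => v _.
have -> : link (fun u => a * y u) v = (fun u => a * link y v u).
  by apply: funext => u; rewrite /link mulrA.
by rewrite IHs exprS; ring.
Qed.

Hypothesis symA : symmetric A.

(* Goodman: two neighbourhoods of masses d and d' in a space of mass W meet in
   mass at least d + d' - W. *)
Lemma goodman y : (forall u, 0 <= y u) ->
  2 * \sum_v y v * (\sum_u link y v u) ^+ 2 - (\sum_v y v) * clique_mass 2 y
  <= clique_mass 3 y.
Proof.
move=> y0; set d := fun v => \sum_u link y v u; set W := \sum_v y v.
have e2 : clique_mass 2 y = \sum_v \sum_u y v * y u * (A v u)%:R.
  by rewrite clique_mass2; apply: eq_bigr => v _; rewrite mulr_sumr;
     apply: eq_bigr => u _; rewrite /link mulrA.
have e3 : clique_mass 3 y =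
    \sum_v \sum_u y v * y u * (A v u)%:R * \sum_w y w * (A v w)%:R * (A u w)%:R.
  rewrite clique_massS.
  under eq_bigr => v _ do rewrite clique_mass2 mulr_sumr.
  by apply: eq_bigr => v _; apply: eq_bigr => u _; rewrite /link; ring.
have ed2 : \sum_v y v * d v ^+ 2 = \sum_v \sum_u y v * y u * (A v u)%:R * d v.
  apply: eq_bigr => v _; rewrite -mulr_suml expr2 mulrA; congr (_ * _).
  by rewrite mulr_sumr; apply: eq_bigr => u _; rewrite /link mulrA.
have ed2' : \sum_v y v * d v ^+ 2 = \sum_v \sum_u y v * y u * (A v u)%:R * d u.
  rewrite ed2 exchange_big; apply: eq_bigr => v _; apply: eq_bigr => u _.
  by rewrite symA; ring.
rewrite mulr2n mulrDl !mul1r {1}ed2 ed2' e2 e3 mulr_sumr -big_split -sumrB.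
apply: ler_sum => v _ /=; rewrite mulr_sumr -big_split -sumrB.
apply: ler_sum => u _ /=.
rewrite [W * _]mulrC -mulrDr -mulrBr ler_wpM2l ?mulr_ge0 ?ler0n//.
rewrite /d -big_split -sumrB; apply: ler_sum => w _ /=.
by rewrite /link; have := y0 w; case: (A v w); case: (A u w) => /=; lra.
Qed.

(** Second moment as variance plus squared mean, the mean degree being the edge mass over the total
    mass. Supersaturation discards the variance; stability needs it. *)
Lemma sum_degree_sqr y : 0 < \sum_v y v ->
  \sum_v y v * (\sum_u link y v u) ^+ 2 =
  \sum_v y v * (\sum_u link y v u - clique_mass 2 y / \sum_v y v) ^+ 2
    + clique_mass 2 y ^+ 2 / \sum_v y v.
Proof.
move=> W0; set W := \sum_v y v; set t := clique_mass 2 y.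
have tE : \sum_v y v * (\sum_u link y v u) = t by rewrite /t clique_mass2.
have -> : \sum_v y v * (\sum_u link y v u - t / W) ^+ 2 =
  \sum_v y v * (\sum_u link y v u) ^+ 2
   + (- (2 * (t / W)) * \sum_v y v * (\sum_u link y v u)
   + (t / W) ^+ 2 * \sum_v y v).
  rewrite [X in _ + (X + _)]mulr_sumr [X in _ + (_ + X)]mulr_sumr -!big_split.
  by apply: eq_bigr => v _ /=; ring.
by rewrite tE -/W; field; rewrite gt_eqF.
Qed.

End CliqueDensity.
Arguments clique_mass : simpl never.

(** Induction on [r]: the bound for [r] is applied in every link and summed against [y]; Goodman's
    bound and Cauchy-Schwarz then leave an expression in [t] and [W]. Linearity in the excess lets
    links of negative excess enter the sum like all others. *)
Lemma clique_supersaturation (R : realType) (r : nat) (eps : R) : 0 < eps ->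
  exists2 c : R, 0 < c & forall (V : finType) (A : rel V) (y : V -> R),
    symmetric A -> (forall u, 0 <= y u) -> \sum_v y v <= 1 ->
    c * (clique_mass A 2 y - (1 - r.+1%:R^-1) * (\sum_v y v) ^+ 2 - eps)
    <= clique_mass A r.+2 y.
Proof.
elim: r eps => [|r IHr] eps eps0.
  exists 1 => // V A y symA y0 W1.
  by rewrite invr1 subrr mul0r subr0 mul1r lerBlDr lerDl ltW.
(* The error in the links is [eps ^ 2] because the excess will only be multiplied by a factor known
   to be at least [eps]. *)
have [c c0 Hc] := IHr _ (exprn_gt0 2 eps0).
exists (c * eps); first exact: mulr_gt0.
move=> V A y symA y0 W1.
set W := \sum_v y v in W1 *; set t := clique_mass A 2 y.
move Eq2: (r.+2%:R^-1) => q2; move Eq: (r.+1%:R^-1 : R) Hc => q Hc.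
set B := (_ - eps).
have [B0|B0] := leP B 0.
  by rewrite (le_trans _ (clique_mass_ge0 _ _ y0))// mulr_ge0_le0// mulr_ge0// ltW.
have W0 : 0 <= W by exact: sumr_ge0.
have q20 : 0 < q2 by rewrite -Eq2 invr_gt0 ltr0n.
have q21 : q2 <= 1 by rewrite -Eq2 invf_le1 ?ltr0n// ler1n.
have tE : eps <= t.
  have : 0 <= (1 - q2) * W ^+ 2 by rewrite mulr_ge0 ?exprn_ge0// subr_ge0.
  by move: B0; rewrite /B -/t -/W; lra.
have W0' : 0 < W.
  rewrite lt_def W0 andbT; apply/eqP => WE.
  have := clique_mass2_le A y0; rewrite -/W -/t WE expr0n/=; lra.
set D := \sum_v y v * (\sum_u link A y v u) ^+ 2.
have le1 : c * (clique_mass A 3 y - (1 - q) * D - eps ^+ 2 * W)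
    <= clique_mass A r.+3 y.
  rewrite (clique_massS _ r.+2) clique_massS /D /W !mulr_sumr -!sumrB mulr_sumr.
  apply: ler_sum => v _; rewrite [X in X <= _](_ : _ = y v *
    (c * (clique_mass A 2 (link A y v) - (1 - q) *
       (\sum_u link A y v u) ^+ 2 - eps ^+ 2))); last by ring.
  rewrite ler_wpM2l// Hc//; first exact: link_ge0.
  by rewrite (le_trans (sum_link_le _ _ y0)).
apply: le_trans le1; rewrite -mulrA ler_wpM2l ?(ltW c0)//.
have le2 := goodman symA y0; rewrite -/D -/W -/t in le2.
have le3 : t ^+ 2 / W <= D.
  rewrite /D (sum_degree_sqr _ W0') lerDr sumr_ge0// => v _.
  by rewrite mulr_ge0// sqr_ge0.
have qq : q2 = q / (1 + q).
  rewrite -Eq2 -Eq -[r.+2]addn1 natrD; have : 0 < r.+1%:R :> R by rewrite ltr0n.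
  by move=> ?; field; rewrite !gt_eqF//; lra.
have qp : 0 < q by rewrite -Eq invr_gt0 ltr0n.
have le4 : (1 + q) * (t ^+ 2 / W) - W * t <= clique_mass A 3 y - (1 - q) * D.
  have : (1 + q) * (t ^+ 2 / W) <= (1 + q) * D by rewrite ler_wpM2l//; lra.
  by lra.
(* As [1 - q2 = 1 / (1 + q)], Goodman's lower bound vanishes at the Turan density and the excess
   [B + eps] factors out. *)
have eB : (1 + q) * (t ^+ 2 / W) - W * t = (1 + q) * (t / W) * (B + eps).
  by rewrite /B -/t -/W qq; field; rewrite !gt_eqF//; lra.
have tW : eps <= t / W by rewrite ler_pdivlMr// (le_trans _ tE)// ler_piMr// ltW.
have : eps * (B + eps) <= (1 + q) * (t / W) * (B + eps).
  rewrite ler_wpM2r//; first lra.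
  rewrite (le_trans tW)// ler_peMl//; lra.
have : eps ^+ 2 * W <= eps ^+ 2 by rewrite ler_piMr ?exprn_ge0// ltW.
by move: le4; rewrite eB; lra.
Qed.

(** * Stability of the clique density *)

Lemma exists_le_average (R : realType) (V : finType) (y Q : V -> R) (s : R) :
  (forall v, 0 <= y v) -> 0 < \sum_v y v ->
  \sum_v y v * Q v <= s * \sum_v y v -> exists v, Q v <= s.
Proof.
move=> y0 W0 le_s; apply: contrapT => /forallNP Qs.
have Q_gt v : s < Q v by rewrite ltNge; apply/negP/Qs.
have pos v : 0 <= y v * (Q v - s) by rewrite mulr_ge0// subr_ge0 ltW.
have y_eq0 : \sum_v y v * (Q v - s) = 0.
  apply/eqP; rewrite eq_le sumr_ge0 ?andbT//.
  under eq_bigr => v _ do rewrite mulrBr [y v * s]mulrC.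
  by rewrite sumrB -mulr_sumr subr_le0.
move: W0; rewrite big1 ?ltxx// => v _.
have /eqP : y v * (Q v - s) = 0 by apply: (psumr_eq0P _ y_eq0).
by rewrite mulf_eq0 subr_eq0 [Q v == s]gt_eqF ?orbF ?Q_gt// => /eqP.
Qed.

(* With [z] the weight inside the neighbourhood of [v] and [o] the weight
outside, the last four terms add up to [o u * o w * (A u w)]. *)
Lemma colored_edge_le (R : realType) (V : finType) (A : rel V) (y : V -> R)
    (r : nat) (v : V) (f : V -> 'I_r.+1) (u w : V) :
  (forall u, 0 <= y u) -> symmetric A ->
  let z := link A y v in let o u := y u - z u in
  let g u := if A v u then lift ord0 (f u) else ord0 in
  y u * y w * (A u w && (g u == g w))%:R <=
  z u * z w * (A u w && (f u == f w))%:R +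
   (z u * z w * (A u w)%:R + o u * (y w * (A u w)%:R)
    + o w * (y u * (A w u)%:R) - y u * (y w * (A u w)%:R)).
Proof.
move=> y0 symA /=; rewrite /link (symA w u).
case: (A u w) => /=; last by lra.
by case: (A v u); case: (A v w) => //=; rewrite ?(inj_eq lift_inj)//; lra.
Qed.

(** The left side bounds, up to errors, the edge mass among the non-neighbours of a vertex of degree
    [d]: edges inside the neighbourhood, plus twice those leaving the complement, minus all edges.
    At [d = rho] both main terms coincide, and moving [d] by [be] costs at most [4 * be]. *)
Lemma degree_estimate (R : realFieldType) (a d rho W be : R) :
  0 <= a -> a <= 1 -> 0 <= d -> d <= W -> W <= 1 -> 0 <= rho -> rho <= W ->
  `|d - rho| <= be ->
  (1 - a) * d ^+ 2 + 2 * ((W - d) * rho) - rho * W <=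
  rho * (W - (1 + a) * rho) + 4 * be.
Proof.
move=> a0 a1 d0 dW W1 rho0 rhoW; rewrite ler_norml => /andP[dr1 dr2].
have be0 : 0 <= be by lra.
have le1 : (1 - a) * ((d - rho) * (d + rho)) <= 1 * (be * 2).
  have [neg|pos] := leP (d - rho) 0.
    rewrite (@le_trans _ _ 0) ?mulr_ge0//.
    by rewrite mulr_ge0_le0 ?subr_ge0// mulr_le0_ge0// addr_ge0.
  have p1 := ltW pos; have p2 : 0 <= d + rho by lra.
  by apply: ler_pM; [lra|rewrite mulr_ge0|lra|apply: ler_pM; lra].
have le2 : (rho - d) * rho <= be * 1.
  have [neg|pos] := leP (rho - d) 0.
    by rewrite (@le_trans _ _ 0) ?mulr_ge0// mulr_le0_ge0.
  by apply: ler_pM; lra.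
by lra.
Qed.

(** Averaging finds a vertex [v] of nearly average degree whose link is nearly extremal and has few
    cliques. The induction hypothesis colours the link, and the non-neighbours of [v], which span
    few edges, receive one new colour. *)
Lemma clique_stability (R : realType) (r : nat) (eps : R) : 0 < eps ->
  exists2 delta : R, 0 < delta & forall (V : finType) (A : rel V) (y : V -> R),
    symmetric A -> (forall u, 0 <= y u) -> \sum_v y v <= 1 ->
    (1 - r.+1%:R^-1) * (\sum_v y v) ^+ 2 - delta <= clique_mass A 2 y ->
    clique_mass A r.+2 y <= delta ->
    exists f : V -> 'I_r.+1,
      \sum_v \sum_u y v * y u * (A v u && (f v == f u))%:R <= eps.
Proof.
(* Any colouring has at most the full edge mass inside its classes; this settles [r = 0] and the
   case of small total mass. *)
have mono_le r' (V : finType) (A : rel V) (y : V -> R) (f : V -> 'I_r'.+1) :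
    (forall u, 0 <= y u) ->
    \sum_v \sum_u y v * y u * (A v u && (f v == f u))%:R <= clique_mass A 2 y.
  move=> y0; rewrite clique_mass2; apply: ler_sum => v _.
  rewrite mulr_sumr; apply: ler_sum => u _; rewrite mulrA /link ler_wpM2l ?mulr_ge0//.
  by case: (A v u); rewrite //= lern1 leq_b1.
elim: r eps => [|r IHr] eps eps0.
  exists eps => // V A y _ y0 _ _ t_le; exists (fun=> ord0).
  exact: le_trans (mono_le _ _ _ _ _ y0) t_le.
have eps4 : 0 < eps / 4 by rewrite divr_gt0.
have [d1 d10 IH] := IHr _ eps4.
pose be := eps / 40; have be0 : 0 < be by rewrite divr_gt0.
(* Below [d1] the induction hypothesis applies to the link; below [be ^ 2] a squared degree
   deviation gives a deviation of at most [be]. *)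
pose s0 := Num.min d1 (be ^+ 2).
have s00 : 0 < s0 by rewrite lt_min d10 exprn_gt0.
have eps10 : 0 < s0 / 4 by rewrite divr_gt0.
have [c c0 Hc] := @clique_supersaturation R r _ eps10.
have ic0 : 0 < c^-1 by rewrite invr_gt0.
(* The part [2 / c] dominates the loss [tau v / c] in [e_le] and yields [de / c <= s0 / 4]; the part
   [1] controls [tau v] itself. *)
pose K := 2 / c + 1; have K0 : 0 < K by rewrite addr_gt0// divr_gt0.
(* Chosen so that [2 * de + K * (de / eps) = s0 / 2]; the division by [eps] pays for averaging the
   clique mass over [W > eps]. *)
pose de := s0 / 2 / (2 + K / eps).
have den0 : 0 < 2 + K / eps by rewrite addr_gt0// divr_gt0.
have de0 : 0 < de by rewrite !divr_gt0.
exists de => // V A y symA y0 W1.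
move Eq2: (r.+2%:R^-1) => b; move Eq: (r.+1%:R^-1 : R) Hc IH => a Hc IH.
have b0 : 0 < b by rewrite -Eq2 invr_gt0 ltr0n.
have a0 : 0 < a by rewrite -Eq invr_gt0 ltr0n.
have a1 : a <= 1 by rewrite -Eq invf_le1 ?ltr0n// ler1n.
have ba : b = a / (1 + a).
  rewrite -Eq2 -Eq -[r.+2]addn1 natrD; have : 0 < r.+1%:R :> R by rewrite ltr0n.
  by move=> ?; field; rewrite !gt_eqF//; lra.
set W := \sum_v y v in W1 *; set t := clique_mass A 2 y.
move=> t_ge T_le.
have W0 : 0 <= W by exact: sumr_ge0.
have tW : t <= W ^+ 2 by exact: clique_mass2_le.
have [Weps|Weps] := leP (W ^+ 2) eps.
  exists (fun=> ord0); apply: le_trans (mono_le _ _ _ _ _ y0) _.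
  exact: le_trans tW Weps.
have WW : W ^+ 2 <= W by rewrite expr2 ler_piMr.
have Wgt : eps < W by exact: lt_le_trans WW.
have W0' : 0 < W by exact: lt_trans Wgt.
have eps1 : eps < 1 by exact: lt_le_trans W1.
have be1 : be <= 1 by rewrite /be; lra.
have be2 : be ^+ 2 <= be by rewrite expr2 ler_piMr// ltW.
have s0d1 : s0 <= d1 by rewrite ge_min lexx.
have s0be : s0 <= be ^+ 2 by rewrite ge_min lexx orbT.
have deE : 2 * de + K * (de / eps) = s0 / 2.
  have -> : K * (de / eps) = K / eps * de by rewrite mulrA mulrAC.
  by rewrite -mulrDl mulrC /de mulfVK// gt_eqF.
have deeps : de <= de / eps by rewrite ler_pdivlMr// ler_piMr// ltW.
have Kde : K * de <= s0 / 2.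
  have : K * de <= K * (de / eps) by rewrite ler_wpM2l// ltW.
  lra.
have de2 : 2 * de <= s0 / 2.
  have : 0 <= K * (de / eps) by rewrite mulr_ge0 ?divr_ge0// ltW.
  lra.
pose d v := \sum_u link A y v u.
pose e v := clique_mass A 2 (link A y v).
pose tau v := clique_mass A r.+2 (link A y v).
pose rho := t / W.
have tE : t = rho * W by rewrite /rho mulfVK// gt_eqF.
have t0 : 0 <= t by exact: clique_mass_ge0.
have rho0 : 0 <= rho by rewrite divr_ge0.
have rhoW : rho <= W by rewrite ler_pdivrMr// -expr2.
have dW v : d v <= W by exact: sum_link_le.
have d0 v : 0 <= d v by apply: sumr_ge0 => u _; exact: link_ge0.
have tau0 v : 0 <= tau v by apply/clique_mass_ge0/link_ge0.
have e_le v : e v <= (1 - a) * d v ^+ 2 + s0 / 4 + tau v / c.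
  have := Hc V A (link A y v) symA (link_ge0 _ _ y0) (le_trans (dW v) W1).
  by rewrite -/(d v) -/(e v) -/(tau v) mulrC -ler_pdivlMr//; lra.
pose Var := \sum_v y v * (d v - rho) ^+ 2.
have Var0 : 0 <= Var by apply: sumr_ge0 => v _; rewrite mulr_ge0// sqr_ge0.
pose De := \sum_v y v * ((1 - a) * d v ^+ 2 - e v).
(* The density hypothesis in terms of the mean degree: the left side is the deficit from the Turan
   density times [(1 + a) * (rho / W)], a factor of at most 2. *)
have bracket : rho * (W - (1 + a) * rho) <= 2 * de.
  have aW : rho * (W - (1 + a) * rho) = (1 + a) * (rho / W) * ((1 - b) * W ^+ 2 - t).
    by rewrite tE ba; field; rewrite !gt_eqF//; lra.
  have rW0 : 0 <= rho / W by rewrite divr_ge0.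
  have rW1 : 0 <= (1 + a) * (rho / W) by rewrite mulr_ge0// addr_ge0// ltW.
  rewrite aW (@le_trans _ _ ((1 + a) * (rho / W) * de))//.
    by rewrite ler_wpM2l// lerBlDl -lerBlDr.
  have : rho / W <= 1 by rewrite ler_pdivrMr// mul1r.
  by move=> ?; rewrite ler_wpM2r ?(ltW de0)// -[2 in leRHS]mulr1 ler_pM//; lra.
have cm3 : clique_mass A 3 y = \sum_v y v * e v by rewrite clique_massS.
have DeE : De = (1 - a) * (Var + t ^+ 2 / W) - clique_mass A 3 y.
  rewrite -(sum_degree_sqr _ W0') cm3 mulr_sumr -sumrB.
  by apply: eq_bigr => v _; rewrite /d; ring.
(* Goodman's bound read as an upper bound on [De]; the coefficient of the variance is
   [2 - (1 - a)]. *)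
have DeVar : De + (1 + a) * Var <= 2 * de * W.
  have := goodman symA y0; rewrite -/W -/t (sum_degree_sqr _ W0').
  rewrite -/W -/t -/rho -/(Var) => good.
  have : W * (rho * (W - (1 + a) * rho)) <= 2 * de * W.
    by rewrite mulrC ler_wpM2r.
  have tt : t ^+ 2 / W = rho ^+ 2 * W by rewrite tE; field; rewrite gt_eqF.
  have Wt : W * t = rho * W * W by rewrite {1}tE; ring.
  rewrite tt Wt in good; rewrite DeE tt; lra.
(* Only the first term of this sum can be negative, and [e_le] bounds it from below; so one small
   sum makes all three quantities small. *)
have [v Qv] : exists v,
    (1 - a) * d v ^+ 2 - e v + ((d v - rho) ^+ 2 + K * tau v) <= s0 / 2.
  apply: (exists_le_average y0 W0'); rewrite -/W -deE.
  rewrite (_ : \sum_v _ = De + Var + K * clique_mass A r.+3 y); last first.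
    rewrite /De /Var (clique_massS _ r.+2) mulr_sumr -!big_split.
    apply: eq_bigr => v _ /=; rewrite /tau; ring.
  rewrite [leRHS]mulrDl lerD//.
    apply: le_trans DeVar; rewrite lerD2l ler_peMl//; lra.
  rewrite -mulrA ler_wpM2l ?(ltW K0)// (le_trans T_le)// mulrAC ler_pdivlMr//.
  by rewrite ler_wpM2l ?ltW.
have tauc0 : 0 <= tau v / c by rewrite divr_ge0// ltW.
have Ktau : K * tau v = tau v / c + tau v / c + tau v by rewrite /K; ring.
have dr0 : 0 <= (d v - rho) ^+ 2 by exact: sqr_ge0.
have ev := e_le v; rewrite Ktau in Qv; have tauv := tau0 v.
have dr_le : `|d v - rho| <= be.
  rewrite -(@ler_pXn2r _ 2) ?nnegrE ?normr_ge0 ?(ltW be0)// real_normK ?num_real//.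
  by rewrite (le_trans _ s0be)//; lra.
have [f' f'_le] : exists f : V -> 'I_r.+1, \sum_u \sum_w link A y v u *
    link A y v w * (A u w && (f u == f w))%:R <= eps / 4.
  apply: IH => //; first exact: link_ge0.
  - exact: le_trans (dW v) W1.
  - by rewrite -/(d v) -/(e v); lra.
  - by rewrite -/(tau v); lra.
pose o u := y u - link A y v u.
have o0 u : 0 <= o u.
  by rewrite /o /link subr_ge0 ler_piMr// lern1 leq_b1.
have so : \sum_u o u = W - d v by rewrite /o sumrB.
(* Non-neighbours of [v] have degree about [rho] on average: [d u - rho] is at most its square over
   [be] plus [be], and the variance is at most [be ^ 2]. *)
have od_le : \sum_u o u * d u <= (W - d v) * rho + 2 * be.
  have le1 u : o u * d u <= o u * rho + (y u * (d u - rho) ^+ 2 / be + y u * be).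
    have oy : o u <= y u by rewrite gerBl link_ge0.
    have le2 : d u - rho <= (d u - rho) ^+ 2 / be + be.
      rewrite -lerBlDr ler_pdivlMr//; have := sqr_ge0 (d u - rho - be).
      have := sqr_ge0 be; have := sqr_ge0 (d u - rho); nra.
    have := ler_wpM2l (o0 u) le2; have : 0 <= (d u - rho) ^+ 2 / be + be.
      by rewrite addr_ge0 ?divr_ge0 ?sqr_ge0// ltW.
    move=> /(ler_wpM2r)/(_ _ _ oy); lra.
  apply: le_trans (ler_sum _ (fun u _ => le1 u)) _.
  rewrite !big_split/= -!mulr_suml so -/Var -/W lerD2l.
  have : Var / be <= be.
    rewrite ler_pdivrMr// -expr2 (le_trans _ s0be)//.
    (* Supersaturation in the links bounds [De] from below, which turns [DeVar] into a bound on the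
       variance alone. *)
    have De_ge : - De <= s0 / 4 * W + de / c.
      rewrite -sumrN (@le_trans _ _ (\sum_u (y u * (s0 / 4) + y u * tau u / c)))//.
        apply: ler_sum => u _; rewrite -mulrN -mulrA -mulrDr ler_wpM2l//.
        by have := e_le u; lra.
      rewrite big_split/= -!mulr_suml -/W mulrC lerD2l ler_wpM2r ?(ltW ic0)//.
    have dec : de / c <= s0 / 4.
      have : K * de = de / c + de / c + de by rewrite /K; ring.
      by have := divr_ge0 (ltW de0) (ltW c0); lra.
    have : s0 / 4 * W <= s0 / 4 by rewrite ler_piMr// ltW.
    have : 2 * de * W <= 2 * de by rewrite ler_piMr// mulr_ge0// ltW.
    have : 0 <= a * Var by rewrite mulr_ge0// ltW.
    by lra.
  have : W * be <= be by rewrite ler_piMl// ltW.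
  by lra.
exists (fun u => if A v u then lift ord0 (f' u) else ord0).
pose le_split u w := colored_edge_le v f' u w y0 symA.
apply: le_trans (ler_sum _ (fun u _ => ler_sum _ (fun w _ => le_split u w))) _.
under eq_bigr => u _ do rewrite big_split/= sumrB 2!big_split/=.
rewrite big_split/= sumrB 2!big_split/=.
have E1 : \sum_u \sum_w link A y v u * link A y v w * (A u w)%:R = e v.
  rewrite /e clique_mass2; apply: eq_bigr => u _; rewrite mulr_sumr.
  by apply: eq_bigr => w _; rewrite [link A (link A y v) u w]/link mulrA.
have E2 : \sum_u \sum_w o u * (y w * (A u w)%:R) = \sum_u o u * d u.
  by apply: eq_bigr => u _; rewrite mulr_sumr.
have E3 : \sum_u \sum_w y u * (y w * (A u w)%:R) = t.
  by rewrite /t clique_mass2; apply: eq_bigr => u _; rewrite mulr_sumr.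
rewrite E1 E2 E3 [X in _ + X - t]exchange_big/= E2.
have := degree_estimate (ltW a0) a1 (d0 v) (dW v) W1 rho0 rhoW dr_le.
have beE : be = eps / 40 by [].
have : t = rho * W by [].
by move: od_le f'_le bracket; lra.
Qed.

(** * Blow-ups of cliques *)

Lemma natr_card (R : pzSemiRingType) (V : finType) (S : {set V}) :
  #|S|%:R = \sum_v (v \in S)%:R :> R.
Proof.
by rewrite -sum1_card natr_sum big_mkcond; apply: eq_bigr => v _; case: (v \in S).
Qed.

Lemma exists_subset_card (V : finType) (S : {set V}) (T : nat) :
  (T <= #|S|)%N -> exists2 U : {set V}, U \subset S & #|U| = T.
Proof.
rewrite cardE => leT; exists [set x in take T (enum S)].
  by apply/fintype.subsetP => x; rewrite inE => /mem_take; rewrite mem_enum.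
rewrite cardsE; have /card_uniqP -> := take_uniq T (enum_uniq S).
by rewrite size_takel.
Qed.

(** Fix a set [U] of boundedly many vertices of high degree. A positive proportion of [W] has at
    least [t] neighbours in [U], and by pigeonhole over the at most [2 ^ T] subsets of [U] one
    [t]-set serves a positive proportion of [W]. *)
Lemma common_points (R : realType) (t : nat) (c : R) : 0 < c ->
  exists2 c' : R, 0 < c' & exists n0 : nat,
    forall (V W : finType) (P : V -> W -> bool),
    (n0 <= #|V|)%N -> (0 < #|W|)%N ->
    c * #|V|%:R * #|W|%:R <= \sum_v \sum_w (P v w)%:R ->
    exists2 B : {set V}, #|B| = t &
      c' * #|W|%:R <= #|[set w | [forall v in B, P v w]]|%:R.
Proof.
move=> c0; have c20 : 0 < c / 2 by rewrite divr_gt0.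
(* With [T] vertices of density at least [c / 2], points of [W] have on average at least [t + 1]
   neighbours among them, one more than required. *)
pose T := (Num.truncn (t.+1%:R / (c / 2))).+1.
have T0 : 0 < T%:R :> R by rewrite ltr0n.
have Tt : t.+1%:R <= T%:R * (c / 2).
  by rewrite -ler_pdivrMr// ltW// truncnS_gt.
have p20 : 0 < 2 ^+ T :> R by rewrite exprn_gt0.
(* Pigeonhole gives twice this proportion; the factor 2 makes the final contradiction strict. *)
exists (2 * T%:R * 2 ^+ T)^-1; first by rewrite invr_gt0 !mulr_gt0.
exists (Num.truncn (T%:R / (c / 2))).+1 => V W P n0V W0 le_P.
have nT : T%:R <= #|V|%:R * (c / 2).
  rewrite -ler_pdivrMr// ltW// (lt_le_trans (truncnS_gt _))// ler_nat//.
have W0R : 0 < #|W|%:R :> R by rewrite ltr0n.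
pose dg v := #|[set w | P v w]|.
have dgE v : (dg v)%:R = \sum_w (P v w)%:R :> R.
  by rewrite natr_card; apply: eq_bigr => w _; rewrite inE.
pose S := [set v | c / 2 * #|W|%:R <= (dg v)%:R].
have dgW v : ((dg v)%:R <= #|W|%:R :> R) by rewrite ler_nat max_card.
have leTS : (T <= #|S|)%N.
  rewrite -(ler_nat R) (le_trans nT)//.
  suff : c * #|V|%:R * #|W|%:R <= (#|S|%:R + #|V|%:R * (c / 2)) * #|W|%:R.
    by rewrite ler_pM2r//; lra.
  apply: (le_trans le_P); rewrite mulrDl.
  rewrite (@le_trans _ _ (\sum_v ((v \in S)%:R * #|W|%:R + c / 2 * #|W|%:R)))//.
    apply: ler_sum => v _; rewrite inE -dgE.
    case: (leP _ (dg v)%:R) => /= le_v.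
      by rewrite mul1r (le_trans (dgW v))// lerDl mulr_ge0 ?ltW.
    by rewrite mul0r add0r ltW.
  rewrite big_split/= -mulr_suml lerD//.
    by rewrite natr_card.
  by rewrite sumr_const -[_ *+ #|_|]mulr_natl mulrA.
have [U subU cardU] := exists_subset_card leTS.
pose a w := #|[set v in U | P v w]|.
have aT w : (a w)%:R <= T%:R :> R.
  rewrite ler_nat -cardU; apply: subset_leq_card.
  by apply/fintype.subsetP => v; rewrite inE => /andP[].
have sum_a : t.+1%:R * #|W|%:R <= \sum_w (a w)%:R :> R.
  rewrite (@le_trans _ _ (\sum_(v in U) c / 2 * #|W|%:R))//.
    by rewrite sumr_const cardU -[_ *+ T]mulr_natl mulrA ler_wpM2r// ltW.
  rewrite (@le_trans _ _ (\sum_(v in U) (dg v)%:R))//.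
    by apply: ler_sum => v /(fintype.subsetP subU); rewrite inE.
  under eq_bigr do rewrite dgE; rewrite exchange_big/=; apply: ler_sum => w _.
  rewrite natr_card big_mkcond/=; apply: ler_sum => v _.
  by rewrite inE; case: (v \in U).
pose W' := [set w | (t <= a w)%N].
have leW' : #|W|%:R <= T%:R * #|W'|%:R :> R.
  have : \sum_w (a w)%:R <= T%:R * #|W'|%:R + t%:R * #|W|%:R :> R.
    rewrite (@le_trans _ _ (\sum_w (T%:R * (w \in W')%:R + t%:R)))//.
      apply: ler_sum => w _; rewrite inE; case: leqP => /= [_|le_t].
        by rewrite mulr1 (le_trans (aT w))// lerDl.
      by rewrite mulr0 add0r ler_nat ltnW.
    rewrite big_split/= -mulr_sumr sumr_const -[_ *+ #|_|]mulr_natr lerD2r.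
    by rewrite natr_card.
  by move=> /(le_trans sum_a); rewrite -natr1; lra.
pose BB := [set B : {set V} | (B \subset U) && (#|B| == t)].
pose N (B : {set V}) := #|[set w | [forall v in B, P v w]]|.
have leBB : #|BB|%:R <= 2 ^+ T :> R.
  rewrite -natrX ler_nat -cardU -card_powerset; apply: subset_leq_card.
  by apply/fintype.subsetP => B; rewrite !inE => /andP[].
have W'N : #|W'|%:R <= \sum_(B in BB) (N B)%:R :> R.
  rewrite natr_card; under [leRHS]eq_bigr do rewrite natr_card.
  rewrite [leRHS]exchange_big; apply: ler_sum => w _; rewrite inE.
  case: leqP => /= [|_]; last by rewrite sumr_ge0.
  case/exists_subset_card => B subB cardB; rewrite (bigD1 B)/=; last first.
    rewrite inE cardB eqxx andbT; apply: fintype.subset_trans subB _.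
    by apply/fintype.subsetP => v; rewrite inE => /andP[].
  rewrite inE (_ : [forall v in B, P v w]) ?lerDl ?sumr_ge0//.
  by apply/forall_inP => v /(fintype.subsetP subB); rewrite inE => /andP[].
apply: contrapT => noB.
have : \sum_(B in BB) (N B)%:R <= 2 ^+ T * ((2 * T%:R * 2 ^+ T)^-1 * #|W|%:R) :> R.
  rewrite (@le_trans _ _ (\sum_(B in BB) (2 * T%:R * 2 ^+ T)^-1 * #|W|%:R))//.
    apply: ler_sum => B; rewrite inE => /andP[_ /eqP cardB].
    by rewrite leNgt; apply/negP => /ltW leB; apply: noB; exists B.
  by rewrite sumr_const -[_ *+ #|_|]mulr_natl ler_wpM2r// mulr_ge0 ?invr_ge0.
rewrite (_ : _ * (_ * _) = #|W|%:R / (2 * T%:R)); last first.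
  by field; rewrite !gt_eqF.
move=> /(le_trans W'N); rewrite ler_pdivlMr ?mulr_gt0//; lra.
Qed.

Section CliqueCount.
Variables (R : realType) (V : finType) (A : rel V).
Implicit Types X Y : V -> bool.

(** Nested pairs instead of tuples, so that the recursion of [is_clique_in] matches that of
    [clique_mass]. *)
Fixpoint vertex_seq (s : nat) : finType :=
  if s is s'.+1 then (V * vertex_seq s')%type else unit.

Fixpoint is_clique_in (s : nat) X : vertex_seq s -> bool :=
  match s with
  | 0 => fun=> true
  | s'.+1 => fun w => X w.1 && is_clique_in (fun u => X u && A w.1 u) w.2
  end.

Lemma card_vertex_seq s : #|vertex_seq s| = (#|V| ^ s)%N.
Proof. by elim: s => [|s IHs]; rewrite ?card_unit// card_prod IHs expnS. Qed.

Lemma clique_mass_indicator s X :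
  clique_mass A s (fun u => (X u)%:R) = \sum_w (@is_clique_in s X w)%:R :> R.
Proof.
elim: s X => [|s IHs] X; first by rewrite big_const card_unit /= addr0.
rewrite clique_massS; under eq_bigr => v _.
  rewrite (_ : link A _ v = fun u => (X u && A v u)%:R); last first.
    by apply: funext => u; rewrite /link -natrM mulnb.
  rewrite IHs mulr_sumr; under eq_bigr do rewrite -natrM mulnb.
  over.
by rewrite pair_bigA.
Qed.

Lemma sub_is_clique_in s X Y (w : vertex_seq s) :
  (forall u, X u -> Y u) -> is_clique_in X w -> is_clique_in Y w.
Proof.
elim: s X Y w => [//|s IHs] X Y [x w] /= XY /andP[/XY-> /=].
by apply: IHs => u /andP[/XY-> ->].
Qed.

(** A clique lying in every link of [B] lies in the common neighbourhood. The member [v0] supplies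
    what does not depend on the link: membership in [X] and adjacency within the clique. *)
Lemma is_clique_in_forall s X (B : {set V}) (v0 : V) (w : vertex_seq s) :
  v0 \in B ->
  (forall v, v \in B -> is_clique_in (fun u => X u && A v u) w) ->
  is_clique_in (fun u => X u && [forall v in B, A v u]) w.
Proof.
move=> Bv0; elim: s X w => [//|s IHs] X [x w] /= clX.
have /andP[/andP[-> _] _] := clX _ Bv0.
have -> /= : [forall v in B, A v x].
  by apply/forall_inP => v /clX /andP[/andP[]].
apply: (@sub_is_clique_in _ (fun u => (X u && A x u) && [forall v in B, A v u])).
  by move=> u /andP[/andP[-> ->] ->].
apply: IHs => v /clX/andP[_]; apply: sub_is_clique_in => u.
by move=> /andP[/andP[-> ->] ->].
Qed.

End CliqueCount.

(** Induction on [s], viewing an [(s+1)]-clique as a vertex joined to an [s]-clique: [common_points]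
    gives a first class [B] shared by a positive proportion of [s]-cliques, and these lie in the
    common neighbourhood of [B]. The restriction is carried by [X], so densities stay relative to
    the whole of [V]. *)
Lemma complete_multipartite_of_cliques (R : realType) (t s : nat) (c : R) :
  (0 < t)%N -> 0 < c -> exists n0 : nat,
  forall (V : finType) (A : rel V) (X : V -> bool), symmetric A ->
  (n0 <= #|V|)%N -> c * #|V|%:R ^+ s <= clique_mass A s (fun u => (X u)%:R) ->
  exists B : nat -> {set V},
  [/\ forall i, (i < s)%N -> #|B i| = t,
      forall i x, (i < s)%N -> x \in B i -> X x &
      forall i j x y, (i < s)%N -> (j < s)%N -> i != j ->
        x \in B i -> y \in B j -> A x y].
Proof.
move=> t0; elim: s c => [|s IHs] c c0.
  by exists 0%N => V *; exists (fun=> finset.set0).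
have [c' c'0 [n1 Hn1]] := common_points t c0.
have [n2 Hn2] := IHs c' c'0.
exists (maxn 1 (maxn n1 n2)) => V A X symA; rewrite !geq_max.
move=> /and3P[n0V n1V n2V] le_cl.
have W0 : (0 < #|vertex_seq V s|)%N by rewrite card_vertex_seq expn_gt0 n0V.
pose P v (w : vertex_seq V s) := X v && is_clique_in A (fun u => X u && A v u) w.
have [|||B cardB leB] := Hn1 V (vertex_seq V s) P => //.
  rewrite card_vertex_seq natrX -mulrA -exprS (le_trans le_cl)//.
  by rewrite clique_mass_indicator pair_bigA.
have [v0 Bv0] : exists v, v \in B by apply/card_gt0P; rewrite cardB.
have BX x : x \in B -> X x.
  have : (0 < #|[set w | [forall v in B, P v w]]|)%N.
    by rewrite -(ltr_nat R) (lt_le_trans _ leB)// mulr_gt0// ltr0n.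
  by case/card_gt0P => w; rewrite inE => /forall_inP Pw /Pw/andP[].
pose X' u := X u && [forall v in B, A v u].
have [|B' [cardB' BX' AB']] := Hn2 V A X' symA n2V.
  rewrite -natrX -card_vertex_seq (le_trans leB)// natr_card clique_mass_indicator.
  apply: ler_sum => w _; rewrite inE ler_nat.
  case: forall_inP => //= Pw; rewrite lt0b.
  by apply: (is_clique_in_forall Bv0) => v /Pw/andP[].
exists (fun i => if i is i'.+1 then B' i' else B); split.
- by case=> [|i] //; apply: cardB'.
- by case=> [|i] x lt_i; [exact: BX|move=> /BX'-/(_ lt_i)/andP[]].
case=> [|i] [|j] x y lt_i lt_j // ij Bx By.
- by have /andP[_ /forall_inP] := BX' _ _ lt_j By; apply.
- by have /andP[_ /forall_inP] := BX' _ _ lt_i Bx; rewrite symA; apply.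
exact: (AB' i j).
Qed.

(** * Edit distance to the Turan graph *)

Definition adj (n : nat) (G : {set {set 'I_n}}) : rel 'I_n :=
  fun u v => [set u; v] \in G.

Lemma adj_sym n (G : {set {set 'I_n}}) : symmetric (adj G).
Proof. by move=> u v; rewrite /adj finset.setUC. Qed.

Lemma adj_irr n (G : {set {set 'I_n}}) u : is_graph G -> adj G u u = false.
Proof.
move=> /forall_inP gG; apply/negP => /gG.
by rewrite finset.setUid cards1.
Qed.

Lemma edgeP n (G : {set {set 'I_n}}) e : is_graph G -> e \in G ->
  exists u v, [/\ u != v, e = [set u; v]%SET & adj G u v].
Proof.
move=> /forall_inP gG eG; have /cards2P[u [v [uv e_eq]]] := gG _ eG.
by exists u, v; split=> //; rewrite /adj -e_eq.
Qed.

(* At a permutation with the fewest mismatches no colour is at once missing at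
some point and misplaced at another: composing with a transposition would be an
improvement. *)
Lemma exists_perm_few_mismatches (R : realType) (T C : finType) (f g : T -> C) :
  exists s : {perm T}, #|[set x | f (s x) != g x]|%:R <=
    \sum_c Num.max 0 (#|[set x | f x == c]|%:R - #|[set x | g x == c]|%:R) :> R.
Proof.
pose ma (s : {perm T}) := [set x | f (s x) == g x].
have [s _ s_max] := @arg_maxnP _ (1%g : {perm T}) xpredT (fun s => #|ma s|) isT.
exists s; rewrite natr_card.
have -> : \sum_x (x \in [set x | f (s x) != g x])%:R =
    \sum_c #|[set x | (f (s x) == c) && (g x != c)]|%:R :> R.
  under [RHS]eq_bigr do rewrite natr_card.
  rewrite exchange_big; apply: eq_bigr => x _; rewrite (bigD1 (f (s x)))//= big1.
    by rewrite !inE eqxx addr0 eq_sym.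
  by move=> c cx; rewrite inE eq_sym (negPf cx).
apply: ler_sum => c _; set D := [set x | _].
have [->|[x' Dx']] := set_0Vmem D; first by rewrite cards0 le_max lexx.
rewrite le_max; apply/orP; right.
have sub_gf : [set x | g x == c] \subset [set x | f (s x) == c].
  apply/fintype.subsetP => x; rewrite !inE => /eqP gx; apply/negPn/negP => fx.
  have /andP[/eqP fx' gx'] : (f (s x') == c) && (g x' != c) by rewrite inE in Dx'.
  have := s_max (tperm x x' * s)%g isT.
  apply/negP; rewrite -ltnNge; apply: proper_card; apply/properP; split.
    apply/fintype.subsetP => z; rewrite !inE permM => /eqP fz.
    case: tpermP => [zx|zx'|_ _]; last by rewrite fz.
      by rewrite zx fx' gx eqxx.
    by move: gx'; rewrite -fx' -zx' fz eqxx.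
  exists x; first by rewrite inE permM tpermL fx' gx.
  by rewrite inE gx.
rewrite lerBrDr -natrD ler_nat.
rewrite (_ : #|[set x | f x == c]| = #|[set x | f (s x) == c]|); last first.
  rewrite -[RHS](card_imset _ (@perm_inj _ s)); apply: eq_card => x.
  rewrite inE; apply/idP/imsetP => [fx|[z + ->]]; last by rewrite inE.
  by exists ((s^-1)%g x); rewrite ?inE permKV.
rewrite -(cardsID [set x | g x == c] [set x | f (s x) == c]) addnC leq_add//.
  by rewrite (finset.setIidPr sub_gf).
by apply: subset_leq_card; apply/fintype.subsetP => x; rewrite !inE andbC.
Qed.

(** The numbers [j * r + c] with [j < n %/ r] are distinct and below [n]. *)
Lemma card_residue_ge (n r c : nat) : (c < r)%N ->
  (n %/ r <= #|[set x : 'I_n | (x %% r)%N == c]|)%N.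
Proof.
move=> cr; have lt_n (j : 'I_(n %/ r)) : (j * r + c < n)%N.
  have : (j.+1 * r <= n %/ r * r)%N by rewrite leq_mul2r ltn_ord orbT.
  rewrite mulSn => /leq_trans/(_ (leq_divM _ _)); apply: leq_trans.
  by rewrite addnC ltn_add2r.
rewrite -[leqLHS]card_ord -(@card_imset _ _ (fun j => Ordinal (lt_n j))).
  apply: subset_leq_card; apply/fintype.subsetP => x /imsetP[j _ ->].
  by rewrite inE /= modnMDl modn_small.
move=> i j /(congr1 val) /= /addIn /eqP; rewrite eqn_pmul2r ?(leq_ltn_trans _ cr)//.
by move=> /eqP/val_inj.
Qed.

Lemma bigmin_le_term (T : eqType) (l : seq T) (F : T -> nat) (k : nat) (x : T) :
  x \in l -> (\big[minn/k]_(y <- l) F y <= F x)%N.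
Proof.
elim: l => // a l IHl; rewrite inE big_cons geq_min => /predU1P[->|/IHl->].
  by rewrite leqnn.
by rewrite orbT.
Qed.

(** Every edge of the symmetric difference comes from an ordered pair on which the two adjacencies
    disagree; [s^-1] reads off the Turan class of a relabelled vertex. *)
Lemma edit_dist_turan_le (n r : nat) (G : {set {set 'I_n}}) (s : 'S_n) :
  is_graph G ->
  (edit_dist G (turan n r) <=
   #|[set p : 'I_n * 'I_n | adj G p.1 p.2 !=
       (((s^-1)%g p.1 %% r)%N != ((s^-1)%g p.2 %% r)%N)]|)%N.
Proof.
move=> gG; rewrite /edit_dist.
apply: leq_trans (bigmin_le_term _ _ (mem_index_enum s)) _.
set E := [set p | _].
apply: leq_trans (leq_imset_card (fun p : 'I_n * 'I_n => [set p.1; p.2]) E).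
apply: subset_leq_card; apply/fintype.subsetP => e.
rewrite finset.in_setU !finset.in_setD => /orP[] /andP[].
  move=> nT eG; have [u [v [uv e_eq uvG]]] := edgeP gG eG.
  apply/imsetP; exists (u, v) => //; rewrite inE /= uvG.
  apply: contra nT => /eqP/esym ne; apply/imsetP.
  exists [set (s^-1)%g u; (s^-1)%g v]%SET.
    by rewrite inE; apply/existsP; exists ((s^-1)%g u); apply/existsP;
       exists ((s^-1)%g v); rewrite ne eqxx.
  by rewrite imsetU1 imset_set1 !permKV.
move=> nG /imsetP[e']; rewrite inE => /existsP[x /existsP[y /andP[ne /eqP->]]].
rewrite imsetU1 imset_set1 => e_eq; apply/imsetP; exists (s x, s y) => //.
by rewrite inE /= !permK ne /adj -e_eq (negPf nG).
Qed.

Lemma natr_card_pair (R : pzSemiRingType) (T : finType) (P : T -> T -> bool) :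
  #|[set p | P p.1 p.2]|%:R = \sum_u \sum_v (P u v)%:R :> R.
Proof. by rewrite natr_card pair_bigA; apply: eq_bigr => p _; rewrite inE. Qed.

Lemma sum_color_class (R : realType) (T C : finType) (f : T -> C) :
  \sum_c #|[set x | f x == c]|%:R = #|T|%:R :> R.
Proof.
under eq_bigr do rewrite natr_card.
rewrite exchange_big -sum1_card natr_sum; apply: eq_bigr => x _.
rewrite (bigD1 (f x))//= inE eqxx big1 ?addr0// => c cx.
by rewrite inE eq_sym (negPf cx).
Qed.

Lemma sum_same_color (R : realType) (T C : finType) (f : T -> C) :
  \sum_u \sum_v (f u == f v)%:R = \sum_c #|[set x | f x == c]|%:R ^+ 2 :> R.
Proof.
transitivity (\sum_c \sum_u \sum_v (f u == c)%:R * (f v == c)%:R :> R).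
  rewrite [RHS]exchange_big; apply: eq_bigr => u _; rewrite [RHS]exchange_big.
  apply: eq_bigr => v _; rewrite (bigD1 (f u))//= eqxx mul1r big1 ?addr0.
    by rewrite eq_sym.
  by move=> c cu; rewrite eq_sym (negPf cu) mul0r.
apply: eq_bigr => c _; rewrite natr_card expr2 mulr_suml.
apply: eq_bigr => u _; rewrite mulr_sumr.
by apply: eq_bigr => v _; rewrite !inE.
Qed.

(** Since almost all edges cross classes and there are nearly Turan many, the squared class sizes
    have nearly minimal sum. So the classes are nearly balanced, almost all crossing pairs are
    edges, and a permutation matches [f] with the residue classes up to few vertices. *)
Lemma edit_dist_of_coloring (R : realType) (r : nat) (eps : R) : 0 < eps ->
  exists2 e : R, 0 < e & exists n0 : nat,
  forall (n : nat) (G : {set {set 'I_n}}) (f : 'I_n -> 'I_r.+1),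
  (n0 <= n)%N -> is_graph G ->
  (1 - r.+1%:R^-1 - e) * n%:R ^+ 2 <= \sum_u \sum_v (adj G u v)%:R ->
  \sum_u \sum_v (adj G u v && (f u == f v))%:R <= e * n%:R ^+ 2 ->
  (edit_dist G (turan n r.+1))%:R <= eps * n%:R ^+ 2.
Proof.
move=> eps0; move Eq : (r.+1%:R : R) => q.
have q0 : 0 < q by rewrite -Eq ltr0n.
pose be := eps / (8 * q); have be0 : 0 < be by rewrite divr_gt0// mulr_gt0.
(* Half of [eps] goes to [3 * e + 4 * e / be]; a quarter each goes to the class deviation [be] and
   to rounding, the latter by the choice of the threshold on [n]. *)
pose e := eps / 2 / (3 + 4 / be).
have den0 : 0 < 3 + 4 / be by rewrite addr_gt0// divr_gt0.
have e0 : 0 < e by rewrite !divr_gt0.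
exists e => //; exists (Num.truncn (8 * q / eps)).+1 => n G f n0n gG.
move EN : (n%:R : R) => N A_ge mono_le.
have qeN : 8 * q / eps <= N.
  by rewrite -EN ltW// (lt_le_trans (truncnS_gt _))// ler_nat.
have N0 : 0 < N by rewrite (lt_le_trans _ qeN)// divr_gt0// mulr_gt0.
pose g (x : 'I_n) : 'I_r.+1 := inord (x %% r.+1).
have gE x : val (g x) = (x %% r.+1)%N by rewrite /g /= inordK// ltn_mod.
have [s s_le] := exists_perm_few_mismatches R f g.
pose h u := g ((s^-1)%g u).
pose nc c : R := #|[set x | f x == c]|%:R.
pose Sq := \sum_c nc c ^+ 2.
have SqE : \sum_u \sum_v (f u == f v)%:R = Sq by exact: sum_same_color.
have ncE : \sum_c nc c = N by rewrite sum_color_class card_ord EN.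
have NN : \sum_(u < n) \sum_(v < n) 1 = N ^+ 2 :> R.
  by under eq_bigr do rewrite sumr_const card_ord; rewrite sumr_const card_ord
    EN -mulr_natl EN expr2.
have hM : \sum_u (f u != h u)%:R = #|[set x | f (s x) != g x]|%:R :> R.
  rewrite natr_card (reindex_inj (@perm_inj _ s)); apply: eq_bigr => x _.
  by rewrite inE /h permK.
set M := _%:R in s_le hM.
have VE : \sum_c (nc c - N / q) ^+ 2 = Sq - N ^+ 2 / q.
  transitivity (\sum_c (nc c ^+ 2 - 2 * (N / q) * nc c + (N / q) ^+ 2)).
    by apply: eq_bigr => c _; ring.
  rewrite big_split sumrB/= -mulr_sumr ncE sumr_const card_ord -[_ *+ r.+1]mulr_natl Eq.
  by rewrite -/Sq; field; rewrite gt_eqF.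
have V0 : 0 <= Sq - N ^+ 2 / q.
  by rewrite -VE; apply: sumr_ge0 => c _; exact: sqr_ge0.
have sum2D (F1 F2 : 'I_n -> 'I_n -> R) : \sum_u \sum_v (F1 u v + F2 u v) =
    \sum_u \sum_v F1 u v + \sum_u \sum_v F2 u v.
  by rewrite -big_split; apply: eq_bigr => u _; rewrite big_split.
have sum2N (F : 'I_n -> 'I_n -> R) : \sum_u \sum_v - F u v =
    - \sum_u \sum_v F u v.
  by rewrite -sumrN; apply: eq_bigr => u _; rewrite sumrN.
have Sq_le : Sq <= (q^-1 + 2 * e) * N ^+ 2.
  have : \sum_u \sum_v (adj G u v)%:R <= \sum_u \sum_v
      ((adj G u v && (f u == f v))%:R + (1 - (f u == f v)%:R)) :> R.
    apply: ler_sum => u _; apply: ler_sum => v _.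
    by case: (adj G u v); case: eqP => _ /=; lra.
  by rewrite 2!sum2D sum2N SqE NN; lra.
have edit_le : (edit_dist G (turan n r.+1))%:R <=
   2 * (e * N ^+ 2) + N ^+ 2 - Sq - (1 - q^-1 - e) * N ^+ 2 + 2 * (N * M).
  have := edit_dist_turan_le r.+1 s gG; rewrite -(ler_nat R) => /le_trans; apply.
  rewrite (natr_card_pair R (fun u v : 'I_n => adj G u v !=
    (((s^-1)%g u %% r.+1)%N != ((s^-1)%g v %% r.+1)%N))).
  (* Without mismatches the first five terms equal the disagreement exactly; they are never
     negative, and a mismatch at [u] or [v] adds at least 1. *)
  apply: (@le_trans _ _ (\sum_u \sum_v
     ((adj G u v && (f u == f v))%:R + (adj G u v && (f u == f v))%:R + 1
      + - (f u == f v)%:R + - (adj G u v)%:R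
      + ((f u != h u)%:R + (f v != h v)%:R)))).
    apply: ler_sum => u _; apply: ler_sum => v _; rewrite -!gE.
    rewrite (inj_eq val_inj) -/(h u) -/(h v).
    have [<-|_] := eqVneq (f u) (h u); have [<-|_] := eqVneq (f v) (h v) => /=;
    case: (adj G u v); case: (f u == _) => /=; try case: (_ == _); rewrite /=; lra.
  rewrite 6!sum2D 2!sum2N SqE NN.
  have -> : \sum_u \sum_(v < n) (f u != h u)%:R = N * M :> R.
    rewrite -hM mulr_sumr; apply: eq_bigr => u _.
    by rewrite sumr_const card_ord -[_ *+ n]mulr_natl EN.
  have -> : \sum_(u < n) \sum_v (f v != h v)%:R = N * M :> R.
    by rewrite hM sumr_const card_ord -[_ *+ n]mulr_natl EN.
  lra.
have M_le : M <= q + q * be * N + 2 * e * N / be.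
  apply: (le_trans s_le).
  (* The 1 is the rounding of the residue classes; the rest bounds the surplus of a class over
     [N / q] by a square, to be summed with [VE]. *)
  apply: (@le_trans _ _ (\sum_c (1 + be * N + (nc c - N / q) ^+ 2 / (be * N)))).
    apply: ler_sum => c _; rewrite ge_max.
    have beN : 0 < be * N by rewrite mulr_gt0.
    have sq0 : 0 <= (nc c - N / q) ^+ 2 / (be * N).
      by rewrite divr_ge0 ?sqr_ge0// ltW.
    rewrite addr_ge0 ?addr_ge0// ?(ltW beN)//=.
    have mc : N / q - 1 <= #|[set x | g x == c]|%:R.
      rewrite (_ : #|_| = #|[set x : 'I_n | (x %% r.+1)%N == c]|); last first.
        by apply: eq_card => x; rewrite !inE -val_eqE /= gE.
      rewrite (@le_trans _ _ (n %/ r.+1)%:R)// ?ler_nat ?card_residue_ge//.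
      rewrite lerBlDr ler_pdivrMr// natr1 -EN -Eq -natrM ler_nat ltnW//.
      by rewrite -ltn_divLR.
    have : nc c - N / q <= be * N + (nc c - N / q) ^+ 2 / (be * N).
      rewrite -lerBlDl ler_pdivlMr//.
      have := sqr_ge0 (nc c - N / q - be * N).
      have := sqr_ge0 (be * N); have := sqr_ge0 (nc c - N / q); lra.
    rewrite -/(nc c); lra.
  rewrite big_split/= -mulr_suml VE sumr_const card_ord -[_ *+ r.+1]mulr_natl Eq.
  rewrite mulrDr mulr1 mulrA lerD2l ler_pdivrMr ?(mulr_gt0 be0 N0)//.
  rewrite (_ : 2 * e * N / be * (be * N) = 2 * e * N ^+ 2); first lra.
  by field; rewrite gt_eqF.
have NM : N * M <= N * (q + q * be * N + 2 * e * N / be).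
  exact: ler_wpM2l (ltW N0) _ _ M_le.
have qN : 8 * q * N <= eps * N ^+ 2.
  by rewrite expr2 mulrA ler_wpM2r ?(ltW N0)// -ler_pdivrMl// mulrC.
have eE : 3 * e * N ^+ 2 + 4 * (N * (e * N / be)) = eps / 2 * N ^+ 2.
  have : e * (3 + 4 / be) = eps / 2 by rewrite /e mulfVK// gt_eqF.
  by move=> <-; field; rewrite gt_eqF.
have qb : 8 * (N * (q * be * N)) = eps * N ^+ 2.
  by rewrite /be; field; rewrite gt_eqF.
have e1 : N * (2 * e * N / be) = 2 * (N * (e * N / be)) by ring.
rewrite !mulrDr e1 in NM.
have NqE : (1 - q^-1 - e) * N ^+ 2 = N ^+ 2 - N ^+ 2 / q - e * N ^+ 2 by ring.
rewrite NqE in edit_le.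
have : 2 * (e * N ^+ 2) + N ^+ 2 - Sq - (N ^+ 2 - N ^+ 2 / q - e * N ^+ 2) +
  2 * (N * M) <= eps * N ^+ 2 by lra.
exact: le_trans.
Qed.

(** * The p-spectral radius of F-free graphs *)

Lemma chromatic_number_le k (F : {set {set 'I_k}}) : (chromatic_number F <= k)%N.
Proof.
rewrite /chromatic_number; elim/big_ind: _ => // [x y xk _|c _].
  by rewrite geq_min xk.
by rewrite -ltnS.
Qed.

(** The default value [k] of the minimum is itself admissible, by the identity colouring. *)
Lemma chromatic_number_colorable k (F : {set {set 'I_k}}) :
  colorable F (chromatic_number F).
Proof.
rewrite /chromatic_number; elim/big_ind: _ => [|x y Fx Fy|//].
  apply/existsP; exists [ffun x => x]; apply/forall_inP => e _.
  apply/forall_inP => x _; apply/forall_inP => y _; apply/implyP.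
  by rewrite !ffunE.
by rewrite /minn; case: ifP.
Qed.

(** A vertex [x] goes to the [x]-th element of the class of its colour; distinct classes are
    disjoint because no vertex is adjacent to itself. *)
Lemma contains_sub_of_classes (n k s : nat) (G : {set {set 'I_n}})
    (F : {set {set 'I_k}}) (B : nat -> {set 'I_n}) :
  is_graph G -> is_graph F -> (0 < k)%N -> colorable F s ->
  (forall i, (i < s)%N -> #|B i| = k) ->
  (forall i j x y, (i < s)%N -> (j < s)%N -> i != j ->
    x \in B i -> y \in B j -> adj G x y) -> contains_sub G F.
Proof.
move=> gG gF k0 /existsP[c /forall_inP cP] cardB adjB.
have size_enum (x : 'I_k) : size (enum (B (c x))) = k.
  by rewrite -cardE cardB.
have v0 : 'I_n.
  have : (0 < #|B (c (Ordinal k0))|)%N by rewrite cardB.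
  by move=> /card_gt0P/cid[].
pose phi : {ffun 'I_k -> 'I_n} := [ffun x : 'I_k => nth v0 (enum (B (c x))) x].
have phiB x : phi x \in B (c x) by rewrite ffunE -mem_enum mem_nth// size_enum.
apply/existsP; exists phi; apply/andP; split.
  apply/injectiveP => x y xy; have [cxy|cxy] := eqVneq (c x) (c y).
    apply/val_inj/eqP; move/eqP: xy.
    by rewrite !ffunE cxy nth_uniq ?enum_uniq ?size_enum// -cxy size_enum.
  have := adjB _ _ _ _ (ltn_ord _) (ltn_ord _) cxy (phiB x) (phiB y).
  by rewrite xy adj_irr.
apply/forall_inP => e eF; have [a [b [ab e_eq _]]] := edgeP gF eF.
have /forall_inP/(_ a) := cP e eF; rewrite e_eq finset.set21 => /(_ isT).
move=> /forall_inP/(_ b); rewrite finset.set22 ab => /(_ isT)/= cab.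
rewrite imsetU1 imset_set1.
exact: adjB (ltn_ord _) (ltn_ord _) cab (phiB a) (phiB b).
Qed.

Lemma free_few_cliques (R : realType) (k s : nat) (F : {set {set 'I_k}})
    (kap : R) :
  is_graph F -> (0 < k)%N -> colorable F s -> 0 < kap ->
  exists n0 : nat, forall (n : nat) (G : {set {set 'I_n}}),
  (n0 <= n)%N -> is_graph G -> ~~ contains_sub G F ->
  clique_mass (adj G) s (fun=> 1) <= kap * n%:R ^+ s.
Proof.
move=> gF k0 colF kap0.
have [n0 Hn0] := complete_multipartite_of_cliques s k0 kap0.
exists n0 => n G n0n gG; apply: contraNT; rewrite -ltNge => /ltW le_cl.
have := Hn0 _ (adj G) (fun=> true) (@adj_sym _ G).
rewrite card_ord => /(_ n0n le_cl)[B [cardB _ adjB]].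
exact: contains_sub_of_classes gG gF k0 colF cardB adjB.
Qed.

(** With weights at most [C / n], the clique mass is at most [(C / n) ^ (r+2)] times the number of
    cliques, which is of smaller order than [n ^ (r+2)]; supersaturation then bounds the edge
    mass. *)
Lemma free_weighted_density (R : realType) (k r : nat) (F : {set {set 'I_k}})
    (C eps : R) :
  is_graph F -> (0 < k)%N -> colorable F r.+2 -> 0 < C -> 0 < eps ->
  exists n0 : nat, forall (n : nat) (G : {set {set 'I_n}}) (y : 'I_n -> R),
  (n0 <= n)%N -> is_graph G -> ~~ contains_sub G F ->
  (forall u, 0 <= y u <= C / n%:R) -> \sum_u y u <= 1 ->
  clique_mass (adj G) r.+2 y <= eps /\
  clique_mass (adj G) 2 y <= 1 - r.+1%:R^-1 + eps.
Proof.
move=> gF k0 colF C0 eps0.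
have e20 : 0 < eps / 2 by rewrite divr_gt0.
have [c c0 Hc] := @clique_supersaturation R r _ e20.
pose m := Num.min eps (c * (eps / 2)).
have m0 : 0 < m by rewrite lt_min eps0 mulr_gt0.
have kap0 : 0 < m / C ^+ r.+2 by rewrite divr_gt0// exprn_gt0.
have [n0 Hn0] := free_few_cliques gF k0 colF kap0.
exists (maxn 1 n0) => n G y; rewrite geq_max => /andP[n1 n0n] gG freeG yC W1.
have n0R : 0 < n%:R :> R by rewrite ltr0n.
have y0 u : 0 <= y u by case/andP: (yC u).
have cl_le : clique_mass (adj G) r.+2 y <= m.
  apply: (@le_trans _ _ (clique_mass (adj G) r.+2 (fun u => C / n%:R * 1))).
    by apply: le_clique_mass => u; rewrite mulr1.
  rewrite clique_massZ.
  have -> : m = (C / n%:R) ^+ r.+2 * (m / C ^+ r.+2 * n%:R ^+ r.+2).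
    by rewrite expr_div_n; field; rewrite !expf_neq0// gt_eqF.
  rewrite ler_wpM2l ?exprn_ge0 ?divr_ge0 ?(ltW C0) ?(ltW n0R)//.
  exact: Hn0.
split; first by rewrite (le_trans cl_le)// ge_min lexx.
have := Hc _ _ y (@adj_sym _ G) y0 W1.
move=> /le_trans/(_ cl_le)/le_trans.
have mc : m <= c * (eps / 2) by rewrite ge_min lexx orbT.
move=> /(_ _ mc); rewrite ler_pM2l//.
have W0 : 0 <= \sum_u y u by exact: sumr_ge0.
have : (1 - r.+1%:R^-1) * (\sum_u y u) ^+ 2 <= 1 - r.+1%:R^-1 :> R.
  rewrite ler_piMr// ?exprn_ile1//.
  by rewrite subr_ge0 invf_le1 ?ltr0n// ler1n.
move: (r.+1%:R^-1 : R) => a; lra.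
Qed.

(** * From the p-spectral radius to the edge density *)

Lemma sum_edges (R : realType) n (G : {set {set 'I_n}}) (x : 'I_n -> R) :
  is_graph G -> 2 * \sum_(e in G) \prod_(v in e) x v =
  \sum_u \sum_v x u * x v * (adj G u v)%:R.
Proof.
move=> gG; rewrite pair_bigA/=.
rewrite (eq_bigr (fun p => if adj G p.1 p.2 then x p.1 * x p.2 else 0)); last first.
  by move=> p _; case: (adj G _ _); rewrite (mulr1, mulr0).
rewrite -big_mkcond (partition_big (fun p => [set p.1; p.2]) (mem G))//=.
rewrite mulr_sumr; apply: eq_bigr => e eG.
have [a [b [ab -> abG]]] := edgeP gG eG.
rewrite (bigD1 (a, b))/=; last by rewrite abG eqxx.
rewrite (bigD1 (b, a))/=; last first.
  by rewrite adj_sym abG finset.setUC eqxx xpair_eqE eq_sym (negPf ab).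
rewrite [X in _ + (_ + X)]big1 => [|[u v]]/=.
  by rewrite big_setU1 ?inE// big_set1 /=; ring.
case/andP => /andP[/andP[uvG /eqP uv]]; rewrite !xpair_eqE => nab nba; exfalso.
have : u \in [set a; b]%SET by rewrite -uv finset.set21.
have : v \in [set a; b]%SET by rewrite -uv finset.set22.
have : u != v by apply: contraL uvG => /eqP ->; rewrite adj_irr.
rewrite !inE => + /orP[] /eqP vE /orP[] /eqP uE.
all: by move: nab nba; rewrite uE vE !eqxx.
Qed.

Lemma lambda_p_le (R : realType) (p b : R) n (G : {set {set 'I_n}}) :
  is_graph G -> 0 <= b ->
  (forall x : 'I_n -> R, (forall u, 0 <= x u) -> \sum_u x u `^ p = 1 ->
     \sum_u \sum_v x u * x v * (adj G u v)%:R <= b) ->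
  lambda_p p G <= b.
Proof.
move=> gG b0 Hb; rewrite /lambda_p; set S := (X in sup X).
(* For [n = 0] no vector has norm 1 and [sup] takes its default value 0, hence the hypothesis
   [0 <= b]. *)
have [S0|/set0P S0] := eqVneq S classical_sets.set0; first by rewrite S0 sup0.
apply: ge_sup => // _ [x [x1 ->]]; rewrite sum_edges//.
apply: le_trans (Hb (fun u => `|x u|) _ x1) => //.
apply: ler_sum => u _; apply: ler_sum => v _.
by rewrite -normrM ler_wpM2r// ler_norm.
Qed.

(** Young's inequality for [a = z / (D * tau)] against 1, with equality at [a = 1]. Raising [tau]
    shrinks the coefficient of [z ^ p] at the price of a larger constant term. *)
Lemma young_scaled (R : realType) (n tau z p : R) :
  1 < p -> 0 < n -> 0 < tau -> 0 <= z ->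
  z <= n `^ (2 - 2 / p) *
    (p^-1 * tau `^ (1 - p) * z `^ p + (1 - p^-1) * tau / n ^+ 2).
Proof.
move=> p1 n0 tau0 z0; have p0 : 0 < p by exact: lt_trans p1.
have q0 : 0 < 1 - p^-1 by rewrite subr_gt0 invf_lt1.
have n2 : n `^ 2 = n ^+ 2 by apply: powR_mulrn; exact: ltW.
pose D := n `^ (- (2 / p)).
have D0 : 0 < D by exact: powR_gt0.
have nD : n `^ (2 - 2 / p) = n ^+ 2 * D.
  by rewrite powRD ?n2// (gt_eqF n0) implybT.
have Dp : D `^ p = (n ^+ 2)^-1.
  by rewrite -powRrM mulNr mulfVK ?gt_eqF// powRN n2.
have Dt0 : 0 < D * tau by exact: mulr_gt0.
have tp0 : 0 < tau `^ p by exact: powR_gt0.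
pose a := z / (D * tau); have a0 : 0 <= a by rewrite divr_ge0// ltW.
have zE : z = D * tau * a by rewrite /a mulrC mulfVK// gt_eqF.
have := @conjugate_powR R a 1 p (1 - p^-1)^-1 a0 ler01 p0.
rewrite invr_gt0 q0 invrK addrC subrK powR1 mulr1 mul1r => /(_ isT erefl) young.
have zp : z `^ p = (n ^+ 2)^-1 * tau `^ p * a `^ p.
  by rewrite zE (powRM _ (ltW Dt0) a0) (powRM _ (ltW D0) (ltW tau0)) Dp.
have tE : tau `^ (1 - p) = tau / tau `^ p.
  by rewrite powRB ?powRr1 ?(ltW tau0)// (gt_eqF tau0) implybT.
rewrite nD zp tE.
rewrite [leRHS](_ : _ = D * tau * (a `^ p / p + (1 - p^-1))).
  by rewrite {1}zE ler_wpM2l// ltW.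
by field; rewrite !gt_eqF ?exprn_gt0.
Qed.

Lemma edge_density_of_lambda (R : realType) (k r : nat) (F : {set {set 'I_k}})
    (p eta : R) :
  is_graph F -> (0 < k)%N -> colorable F r.+2 -> 1 < p -> 0 < eta ->
  exists2 delta : R, 0 < delta & exists n0 : nat,
  forall (n : nat) (G : {set {set 'I_n}}),
  (n0 <= n)%N -> is_graph G -> ~~ contains_sub G F ->
  (1 - r.+1%:R^-1 - delta) * (n%:R `^ (2 - 2 / p)) <= lambda_p p G ->
  (1 - r.+1%:R^-1 - eta) * n%:R ^+ 2 <= \sum_u \sum_v (adj G u v)%:R.
Proof.
move=> gF k0 colF p1 eta0; have p0 : 0 < p by exact: lt_trans p1.
pose P := 1 - p^-1; have P0 : 0 < P by rewrite subr_gt0 invf_lt1.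
have ip0 : 0 < p^-1 by rewrite invr_gt0.
(* Four losses of at most [d]: from [delta], from the density of the truncated weight, and two from
   the pairs with a heavy vertex. *)
pose d := P * eta / 4; have d0 : 0 < d by rewrite !mulr_gt0.
pose tau := d `^ (1 - p)^-1; have tau0 : 0 < tau by exact: powR_gt0.
have taud : tau `^ (1 - p) = d.
  by rewrite -powRrM mulVf ?powRr1 ?(ltW d0)// lt_eqF// subr_lt0.
(* At most [n / C] vertices are heavy, so their pairs contribute at most [P * tau * 2 / C = P * d]
   to the constant terms. *)
pose C := 2 * tau / d; have C0 : 0 < C by rewrite divr_gt0// mulr_gt0.
have [n0 Hn0] := free_weighted_density gF k0 colF C0 d0.
exists d => //; exists (maxn 1 n0) => n G; rewrite geq_max => /andP[n1 n0n].
move=> gG freeG; have := Hn0 n G _ n0n gG freeG.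
have : r.+1%:R^-1 <= 1 :> R by rewrite invf_le1 ?ltr0n// ler1n.
move: (r.+1%:R^-1 : R) => q q1 Hy.
have nR0 : 0 < n%:R :> R by rewrite ltr0n.
have n20 : 0 < n%:R ^+ 2 :> R by rewrite exprn_gt0.
set E := \sum_u \sum_v _; set N := _ `^ _.
have N0 : 0 < N by exact: powR_gt0.
have E0 : 0 <= E by apply: sumr_ge0 => u _; exact: sumr_ge0.
(* Pairs of vertices of bounded weight are treated with [tau = 1], for which
   Young's inequality is sharp at the uniform vector; the few remaining pairs
   are made negligible by taking [tau] large. *)
suff lam_le : lambda_p p G <= N * (p^-1 * (1 - q + d) + P * (E / n%:R ^+ 2) + 2 * d).
  move=> /le_trans/(_ lam_le); rewrite mulrC ler_pM2l// -ler_pdivlMr// => le1.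
  have ipd : p^-1 * d <= d by rewrite ler_piMl ?(ltW d0)// ltW// invf_lt1.
  have pE : p^-1 * (1 - q + d) = (1 - P) * (1 - q) + p^-1 * d by rewrite /P; ring.
  have dE : 4 * d = P * eta by rewrite /d; field.
  by rewrite -(ler_pM2l P0); rewrite pE in le1; move: le1 ipd dE; lra.
apply: lambda_p_le => // [|x x0 x1].
  have q0 : 0 <= 1 - q + d by lra.
  have En : 0 <= E / n%:R ^+ 2 by rewrite divr_ge0// ltW.
  by rewrite mulr_ge0 ?(ltW N0)// !addr_ge0// mulr_ge0// ltW.
pose y u := x u `^ p; pose S u := y u <= C / n%:R.
have y0 u : 0 <= y u by exact: powR_ge0.
pose y' u := y u * (S u)%:R.
have y'0 u : 0 <= y' u by rewrite mulr_ge0.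
have [||_ t_le] := Hy y'.
- move=> u; rewrite y'0 /y'; case: (boolP (S u)) => [Su|_]; first by rewrite mulr1.
  by rewrite mulr0 divr_ge0 ?ltW.
- rewrite -x1; apply: ler_sum => u _; rewrite /y' -/(y u).
  by rewrite ler_piMr// lern1 leq_b1.
pose B := \sum_u (~~ S u)%:R : R.
(* Markov's inequality: each heavy vertex has weight above [C / n], and the total weight is 1. *)
have B_le : B <= n%:R / C.
  rewrite ler_pdivlMr// -[leRHS]mul1r -ler_pdivrMr// -mulrA -[leRHS]x1 /B mulr_suml.
  apply: ler_sum => u _; case: (boolP (S u)) => [_|]; first by rewrite mul0r powR_ge0.
  by rewrite mul1r /S -ltNge => /ltW.
have pointwise u v : x u * x v * (adj G u v)%:R <=
   N * (p^-1 * (y' u * (link (adj G) y' u v)) + P / n%:R ^+ 2 * (adj G u v)%:R +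
     p^-1 * d * (y u * y v) + P * tau / n%:R ^+ 2 * ((~~ S u)%:R + (~~ S v)%:R)).
  have [Auv|] := boolP (adj G u v); last first.
    rewrite mulr0 => _; rewrite mulr0 addr0 mulr_ge0 ?(ltW N0)//.
    by rewrite !addr_ge0// ?mulr_ge0 ?divr_ge0 ?link_ge0// ltW// mulr_gt0.
  have xx0 : 0 <= x u * x v by exact: mulr_ge0.
  have xxE : (x u * x v) `^ p = y u * y v by rewrite powRM.
  have a1 : 0 <= p^-1 * (y' u * link (adj G) y' u v).
    by rewrite mulr_ge0 ?(ltW ip0)// mulr_ge0// link_ge0.
  have a2 : 0 <= P / n%:R ^+ 2 by rewrite divr_ge0// ltW.
  have a3 : 0 <= p^-1 * d * (y u * y v) by rewrite !mulr_ge0// ltW.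
  have a4 : 0 <= P * tau / n%:R ^+ 2 by rewrite divr_ge0 ?mulr_ge0// ltW.
  rewrite !mulr1; have [SS|] := boolP (S u && S v).
    apply: le_trans (young_scaled p1 nR0 ltr01 xx0) _.
    rewrite ler_wpM2l ?(ltW N0)// powR1 xxE !mulr1 /link Auv /y'.
    by case/andP: SS => -> ->; rewrite !mulr1 addr0 mulr0 addr0 lerDl.
  rewrite negb_and => SS; apply: le_trans (young_scaled p1 nR0 tau0 xx0) _.
  rewrite ler_wpM2l ?(ltW N0)// taud xxE -/P.
  have : 1 <= (~~ S u)%:R + (~~ S v)%:R :> R.
    by rewrite -natrD ler1n; case/orP: SS => ->; rewrite // addnC.
  by move=> /(ler_wpM2l a4); rewrite mulr1; lra.
apply: le_trans (ler_sum _ (fun u _ => ler_sum _ (fun v _ => pointwise u v))) _.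
have sum2D (F1 F2 : 'I_n -> 'I_n -> R) : \sum_u \sum_v (F1 u v + F2 u v) =
    \sum_u \sum_v F1 u v + \sum_u \sum_v F2 u v.
  by rewrite -big_split; apply: eq_bigr => u _; rewrite big_split.
have sum2Z a (F1 : 'I_n -> 'I_n -> R) : \sum_u \sum_v (a * F1 u v) =
    a * \sum_u \sum_v F1 u v.
  by rewrite mulr_sumr; apply: eq_bigr => u _; rewrite mulr_sumr.
rewrite sum2Z ler_wpM2l ?(ltW N0)// 3!sum2D 4!sum2Z -/E sum2D.
have -> : \sum_u \sum_v y' u * link (adj G) y' u v = clique_mass (adj G) 2 y'.
  by rewrite clique_mass2; apply: eq_bigr => u _; rewrite mulr_sumr.
have -> : \sum_u \sum_v y u * y v = 1.
  under eq_bigr do rewrite -mulr_sumr x1 mulr1.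
  exact: x1.
have -> : \sum_(u < n) \sum_(v < n) (~~ S u)%:R = n%:R * B.
  rewrite /B mulr_sumr; apply: eq_bigr => u _.
  by rewrite sumr_const card_ord -[_ *+ n]mulr_natl.
have -> : \sum_(u < n) \sum_(v < n) (~~ S v)%:R = n%:R * B.
  by rewrite sumr_const card_ord -[_ *+ n]mulr_natl.
have ip1 : p^-1 <= 1 by rewrite ltW// invf_lt1.
have P1 : P <= 1 by rewrite gerBl ltW.
have le1 : P * tau / n%:R ^+ 2 * (n%:R * B + n%:R * B) <= d.
  have : P * tau / n%:R ^+ 2 * (n%:R * B + n%:R * B) <=
         P * tau / n%:R ^+ 2 * (n%:R * (n%:R / C) + n%:R * (n%:R / C)).
    rewrite ler_wpM2l ?divr_ge0 ?mulr_ge0 ?(ltW P0) ?(ltW tau0) ?(ltW n20)//.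
    by rewrite lerD// ler_wpM2l// ltW.
  move=> /le_trans; apply; rewrite [leLHS](_ : _ = P * d).
    by rewrite ler_piMl// ltW.
  by rewrite /C; field; rewrite !gt_eqF.
have le2 : p^-1 * d * 1 <= d by rewrite mulr1 ler_piMl// ltW.
have : p^-1 * clique_mass (adj G) 2 y' <= p^-1 * (1 - q + d).
  by rewrite ler_wpM2l// ltW.
have : P / n%:R ^+ 2 * E = P * (E / n%:R ^+ 2) by ring.
by move: le1 le2; lra.
Qed.

Theorem theorem3p11 (R : realType) (k r : nat) (F : {set {set 'I_k}}) :
  is_graph F -> (2 <= r)%N -> chromatic_number F = r.+1 ->
  forall p : R, 1 < p -> forall eps : R, 0 < eps ->
  exists delta : R, 0 < delta /\
  exists n0 : nat, forall (n : nat) (G : {set {set 'I_n}}),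
    (n0 <= n)%N -> is_graph G -> ~~ contains_sub G F ->
    (1 - r%:R^-1 - delta) * (n%:R `^ (2 - 2 / p)) <= lambda_p p G ->
    (edit_dist G (turan n r))%:R <= eps * n%:R ^+ 2.
Proof.
case: r => [//|r] gF _ chrF p p1 eps eps0.
have colF : colorable F r.+2 by rewrite -chrF chromatic_number_colorable.
have k0 : (0 < k)%N by rewrite (leq_trans _ (chromatic_number_le F))// chrF.
have [e e0 [n1 Hedit]] := @edit_dist_of_coloring R r _ eps0.
have [ds ds0 Hstab] := @clique_stability R r _ e0.
(* The edge density must suffice both for stability ([ds]) and for balancing the classes ([e]). *)
have m0 : 0 < Num.min e ds by rewrite lt_min e0.
have [delta delta0 [n2 Hlam]] := edge_density_of_lambda gF k0 colF p1 m0.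
have [n3 Hfree] := free_weighted_density gF k0 colF (@ltr01 R) ds0.
exists delta; split => //; exists (maxn 1 (maxn n1 (maxn n2 n3))) => n G.
rewrite !geq_max => /and4P[n0 n1n n2n n3n] gG freeG lam_ge.
have nR0 : 0 < n%:R :> R by rewrite ltr0n.
have E_ge := Hlam n G n2n gG freeG lam_ge.
(* The uniform weight meets the bound [C / n] with [C = 1], and its edge mass is the edge density of
   [G]. *)
pose y (_ : 'I_n) : R := n%:R^-1.
have y0 u : 0 <= y u by rewrite invr_ge0 ltW.
have sy : \sum_u y u = 1.
  by rewrite sumr_const card_ord -[_ *+ n]mulr_natl divff// gt_eqF.
have [||cl_le _] := Hfree n G y n3n gG freeG.
- by move=> u; rewrite y0 /y mul1r lexx.
- by rewrite sy.
have cl2 : clique_mass (adj G) 2 y = (\sum_u \sum_v (adj G u v)%:R) / n%:R ^+ 2.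
  rewrite clique_mass2 mulr_suml; apply: eq_bigr => u _.
  rewrite mulr_sumr mulr_suml; apply: eq_bigr => v _.
  by rewrite /link /y; field; rewrite gt_eqF.
have [mine minds] : Num.min e ds <= e /\ Num.min e ds <= ds.
  by rewrite !ge_min !lexx orbT.
have [|||f f_le] := Hstab _ (adj G) y (@adj_sym _ G) y0 => //.
- by rewrite sy.
- rewrite sy cl2 expr1n mulr1 (le_trans (lerB (lexx _) minds))//.
  by rewrite ler_pdivlMr ?exprn_gt0.
apply: (Hedit n G f n1n gG).
  by rewrite (le_trans _ E_ge)// ler_wpM2r ?exprn_ge0 ?(ltW nR0)// lerB.
move: f_le; rewrite -(ler_pM2r (exprn_gt0 2 nR0)); apply: le_trans.
rewrite le_eqVlt; apply/orP; left; apply/eqP.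
rewrite mulr_suml; apply: eq_bigr => u _; rewrite mulr_suml; apply: eq_bigr => v _.
by rewrite /y; field; rewrite gt_eqF.
Qed.
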